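(* Let $A$ be a simple algebra over a field $F$ with $\mathrm{char}(F)\neq 2$, let $X$ be an arbitrary vector space over $F$, and let $\Phi:A\times A\to X$ be a skew-symmetric bilinear map satisfying $$\Phi(x^2,x)=0\quad\text{for all } x\in A.$$ Then $$\Phi(xy,z)+\Phi(zx,y)+\Phi(yz,x)=0$$ for all $x,y,z\in A$.
   Context: Algebras are associative and not necessarily unital. A bilinear map $\Phi$ is skew-symmetric if $\Phi(x,y)=-\Phi(y,x)$ for all $x,y\in A$. *)

(* Defs.v *)
From mathcomp Require Import all_boot all_order all_algebra.

Set Implicit Arguments.
Unset Strict Implicit.
Unset Printing Implicit Defensive.

Import GRing.Theory.
Local Open Scope ring_scope.

(* MathComp's algType assumes a unit, so associative, not necessarily unital
   algebras are introduced here. *)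
Record assocAlgType (F : fieldType) := AssocAlg {
  assocAlg_sort :> lmodType F;
  amul : {bilinear assocAlg_sort -> assocAlg_sort -> assocAlg_sort};
  amulA : associative amul
}.

Arguments amul {F A} : rename.

Notation "x ** y" := (amul x y) (at level 40, left associativity) : ring_scope.

Record two_sided_ideal (F : fieldType) (A : assocAlgType F) (I : A -> Prop) :
    Prop := TwoSidedIdeal {
  ideal0 : I 0;
  idealD : forall x y, I x -> I y -> I (x + y);
  idealZ : forall (c : F) x, I x -> I (c *: x);
  idealMl : forall a x, I x -> I (a ** x);
  idealMr : forall a x, I x -> I (x ** a)
}.

(* An algebra with zero product is not simple, even in dimension 1. *)
Definition simple_algebra (F : fieldType) (A : assocAlgType F) : Prop :=
  (exists x y : A, x ** y != 0) /\
  (forall I : A -> Prop, two_sided_ideal I ->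
     (forall x, I x -> x = 0) \/ (forall x, I x)).

Definition skew_symmetric (U V : zmodType) (f : U -> U -> V) : Prop :=
  forall x y, f x y = - f y x.

(* Main.v *)
Require Import Defs.
From mathcomp Require Import all_boot all_order all_algebra.

Set Implicit Arguments.
Unset Strict Implicit.
Unset Printing Implicit Defensive.

Import GRing.Theory.
Local Open Scope ring_scope.

(* Write T(x,y,z) for the cyclic sum. Polarizing Phi(x^2,x) = 0 shows that T is
   alternating, and associativity makes T a cyclic Hochschild cocycle:
     T(xy,z,w) - T(yz,w,x) + T(zw,x,y) - T(wx,y,z) = 0.
   Antisymmetrizing gives T([x,y],z,w) = - T([z,w],x,y), and together with the
   Jacobi identity T([[a,b],[c,d]],u,v) = 0. By the cocycle identity, the
   radical I = {a | T(a,A,A) = 0} is both a Lie ideal and a subring, so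
   A[a,b]A lies in I for all a, b in I. Hence either I = A, or I is
   commutative; in the latter case Herstein's arguments on Lie ideals give that
   I is central, hence [[A,A],[A,A]] and then [A,A] are central, and A is
   commutative. But then T is symmetric as well as alternating. *)

(** Deduces an equation from a known one, [a = b], leaving a formal identity for [zmod_eq]. *)
Lemma eq_lincomb (V : zmodType) (g h a b : V) :
  a = b -> g - h = a - b -> g = h.
Proof. by move=> -> /eqP; rewrite subrr subr_eq0 => /eqP. Qed.

Lemma double_eq0 (F : fieldType) (V : lmodType F) (v : V) :
  2%N \notin [pchar F] -> v + v = 0 -> v = 0.
Proof.
move=> charF; rewrite -mulr2n -scaler_nat => /eqP.
by rewrite scaler_eq0 => /orP[two0|/eqP //]; rewrite inE /= two0 in charF.
Qed.

Ltac move_to_end t :=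
  repeat match goal with
  | |- context [?x + t + ?z] =>
      tryif constr_eq z t then fail else rewrite (addrAC x t z)
  end.

(* Proves an equality between sums of signed atoms that holds in every abelian
   group. *)
Ltac zmod_eq :=
  apply: subr0_eq; rewrite -[LHS]add0r ?(opprD, opprK, oppr0, addr0, addrA);
  repeat match goal with
  | |- context [- ?t] => move_to_end t; move_to_end (- t); rewrite (addrK t)
  end;
  done.

(** * Simple algebras and Herstein's commutator arguments *)

Section Commutators.
Variables (F : fieldType) (A : assocAlgType F).
Implicit Types x y z a b c : A.

Definition lie x y := x ** y - y ** x.

Lemma lieN x y : - lie x y = lie y x.
Proof. by rewrite /lie opprB. Qed.

Lemma lieDr x y z : lie x (y + z) = lie x y + lie x z.
Proof. by rewrite /lie linearDr linearDl opprD addrACA. Qed.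

Lemma lie_mulr x y z : lie x (y ** z) = lie x y ** z + y ** lie x z.
Proof.
by rewrite /lie !linearBl !linearBr /= !amulA; zmod_eq.
Qed.

Lemma lie_mull x y z : lie (x ** y) z = lie x z ** y + x ** lie y z.
Proof.
by rewrite /lie !linearBl !linearBr /= !amulA; zmod_eq.
Qed.

Lemma jacobi x y z :
  lie (lie x y) z + lie (lie y z) x + lie (lie z x) y = 0.
Proof.
by rewrite /lie !linearBl !linearBr /= !amulA; zmod_eq.
Qed.

Lemma lie0_comm x y : lie x y = 0 -> x ** y = y ** x.
Proof. exact: subr0_eq. Qed.

Hypothesis simpleA : simple_algebra A.

Lemma simple_annihilator_eq0 x : (forall y, x ** y = 0) -> x = 0.
Proof.
move=> x0; have [[u [v uv]] /(_ (fun x => forall y, x ** y = 0))] := simpleA.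
case=> [|zero|all0]; last by rewrite all0 eqxx in uv.
  split=> [y|b c b0 c0 y|k b b0 y|b c c0 y|b c c0 y].
  - exact: linear0l.
  - by rewrite linearDl /= b0 c0 addr0.
  - by rewrite linearZl_LR /= b0 scaler0.
  - by rewrite -amulA c0 linear0r.
  - by rewrite -amulA c0.
exact: zero.
Qed.

(** For fixed [c], the [b] with [bAc = 0] form an ideal. If it is all of [A], then [c] lies in the
    ideal of elements killed by [AA] from the left, which is zero because [u ** v] does not
    annihilate [A]. *)
Lemma simple_prime b c : (forall a, b ** a ** c = 0) -> b = 0 \/ c = 0.
Proof.
move=> bc; have [[u [v uv]] sA] := simpleA.
have /sA[zero|all0] : two_sided_ideal (fun b => forall a, b ** a ** c = 0).
  split=> [y|b1 b2 b10 b20 y|k b1 b10 y|b1 b2 b0 y|b1 b2 b0 y].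
  - by rewrite !linear0l.
  - by rewrite !linearDl /= b10 b20 addr0.
  - by rewrite !linearZl_LR /= b10 scaler0.
  - by rewrite -!amulA (amulA b2) b0 linear0r.
  - by rewrite -(amulA b2) b0.
  by left; apply: zero.
right; have /sA[zero|all1] :
    two_sided_ideal (fun c => forall x a, x ** a ** c = 0).
  split=> [x y|b1 b2 b10 b20 x y|k b1 b10 x y|b1 b2 b0 x y|b1 b2 b0 x y].
  - by rewrite linear0r.
  - by rewrite linearDr /= b10 b20 addr0.
  - by rewrite linearZr_LR /= b10 scaler0.
  - by rewrite amulA -(amulA x) b0.
  - by rewrite amulA b0 linear0l.
  by apply: zero => x a; apply: all0.
case/eqP: uv; apply: simple_annihilator_eq0 => w; exact: all1.
Qed.

Lemma simple_semiprime b : (forall a, b ** a ** b = 0) -> b = 0.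
Proof. by case/simple_prime. Qed.

Hypothesis charF : 2%N \notin [pchar F].

(** By the Leibniz rule, [[a,[a,xy]] = 0] reduces to [2[a,x][a,y] = 0]; putting [yx] for [y] gives
    [[a,x]A[a,x] = 0]. *)
Lemma ad_sqr_eq0 a :
  (forall x, lie a (lie a x) = 0) -> forall x, lie a x = 0.
Proof.
move=> ad2 x.
have ad_mul0 y : lie a x ** lie a y = 0.
  apply: (double_eq0 charF); have := ad2 (x ** y).
  by rewrite lie_mulr lieDr !lie_mulr !ad2 linear0l linear0r addr0 add0r.
apply: simple_semiprime => y.
by have := ad_mul0 (y ** x); rewrite lie_mulr linearDr /= !amulA ad_mul0
   linear0l add0r.
Qed.

Lemma comm_of_central_lie_lie :
  (forall u v x y w, lie (lie (lie u v) (lie x y)) w = 0) ->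
  forall x y, x ** y = y ** x.
Proof.
move=> LL x y; apply: lie0_comm.
have L_central u v w : lie (lie u v) w = 0.
  set a := lie u v; apply: ad_sqr_eq0 => {}w.
  set z := lie a (lie a w); have zC t : lie z t = 0 by exact: LL.
  (* Since [[a,[a,aw]] = az], the product [az] is central along with [z]. *)
  have az0 t : lie a t ** z = 0.
    have := LL u v a (a ** w) t.
    have aa : lie a a = 0 by rewrite /lie subrr.
    rewrite -/a lie_mulr aa linear0l add0r lie_mulr aa linear0l add0r.
    by rewrite lie_mull zC linear0r addr0.
  have zz : z ** z = 0 by exact: az0.
  by apply: simple_semiprime => t; rewrite (lie0_comm (zC t)) -amulA zz linear0r.
by apply: ad_sqr_eq0 => w; rewrite -lieN L_central oppr0.
Qed.

End Commutators.

(** * The cyclic sum: alternation, cocycle identity, commutators *)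

Section CyclicSum.
Variables (F : fieldType) (A : assocAlgType F) (X : lmodType F).
Variable Phi : {bilinear A -> A -> X}.
Hypothesis charF : 2%N \notin [pchar F].
Hypothesis Phi_skew : skew_symmetric Phi.
Hypothesis Phi_sq : forall x : A, Phi (x ** x) x = 0.
Implicit Types x y z w a b c u v : A.

Definition cyc_sum x y z := Phi (x ** y) z + Phi (z ** x) y + Phi (y ** z) x.
Local Notation T := cyc_sum.

Lemma cyc_sum_rot x y z : T x y z = T y z x.
Proof. by rewrite /T; zmod_eq. Qed.

Lemma cyc_sumD x x' y z : T (x + x') y z = T x y z + T x' y z.
Proof.
by rewrite /T !(linearDl, linearDr) /=; zmod_eq.
Qed.

Lemma cyc_sumN x y z : T (- x) y z = - T x y z.
Proof.
by rewrite /T !(linearNl, linearNr) /=; zmod_eq.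
Qed.

Lemma cyc_sumZ k x y z : T (k *: x) y z = k *: T x y z.
Proof.
by rewrite /T !(linearZl_LR, linearZr_LR) /= -?scalerDr.
Qed.

Lemma cyc_sum0 y z : T 0 y z = 0.
Proof. by rewrite -(scale0r 0) cyc_sumZ scale0r. Qed.

(** Expanding at [s + t] mixes the parts of degree (2,1) and (1,2); adding the cases [(x, y)] and
    [(y, -x)] isolates twice the first. *)
Lemma Phi_sq_polar x y : Phi (x ** y) x + Phi (y ** x) x + Phi (x ** x) y = 0.
Proof.
have polar s t : Phi (s ** t) s + Phi (t ** s) s + Phi (s ** s) t
    + (Phi (t ** s) t + Phi (s ** t) t + Phi (t ** t) s) = 0.
  apply: (eq_lincomb (Phi_sq (s + t))).
  rewrite !(linearDl, linearDr) /= !Phi_sq.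
  by zmod_eq.
apply: (double_eq0 charF).
apply: (eq_lincomb (f_equal2 +%R (polar x y) (polar y (- x)))).
by rewrite !(linearNl, linearNr, opprK) /=; zmod_eq.
Qed.

(** Polarizing [Phi_sq_polar] in its quadratic variable yields [T x y z + T y x z]. *)
Lemma cyc_sum_swap x y z : T x y z = - T y x z.
Proof.
have := Phi_sq_polar (x + z) y.
rewrite !(linearDl, linearDr) /= => E.
apply: (eq_lincomb (f_equal2 +%R E (f_equal -%R
  (f_equal2 +%R (Phi_sq_polar x y) (Phi_sq_polar z y))))).
by rewrite /T; zmod_eq.
Qed.

Lemma cyc_sum_swapr x y z : T x y z = - T x z y.
Proof. by rewrite cyc_sum_rot cyc_sum_swap -cyc_sum_rot. Qed.

(** Terms with a triple product cancel by associativity, the others by skew-symmetry. *)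
Lemma cyc_sum_cocycle x y z w :
  T (x ** y) z w - T (y ** z) w x + T (z ** w) x y - T (w ** x) y z = 0.
Proof.
rewrite /T !amulA (Phi_skew (z ** w) (x ** y)) (Phi_skew (w ** x) (y ** z)).
by zmod_eq.
Qed.

(* The difference of the two sides is invariant under the 4-cycle (x y z w) but
   changes sign under the transposition (x y), whereas both permutations are
   odd and generate S_4. *)
Lemma cyc_sum_lie x y z w : T (lie x y) z w = - T (lie z w) x y.
Proof.
pose B x y z w := T (lie x y) z w + T (lie z w) x y.
have B_rot s t u v : B s t u v = B t u v s.
  apply: (eq_lincomb (f_equal2 +%R (cyc_sum_cocycle s t u v)
    (f_equal -%R (cyc_sum_cocycle u t s v)))).
  rewrite /B /lie !(cyc_sumD, cyc_sumN).
  rewrite (cyc_sum_swapr (t ** s) v u) (cyc_sum_swapr (u ** t) s v).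
  rewrite (cyc_sum_swapr (v ** u) t s) (cyc_sum_swapr (s ** v) u t).
  by zmod_eq.
have B_skew s t u v : B s t u v = - B t s u v.
  rewrite /B /lie !(cyc_sumD, cyc_sumN).
  rewrite (cyc_sum_swapr (u ** v) s t) (cyc_sum_swapr (v ** u) s t).
  by zmod_eq.
apply: (eq_lincomb (b := 0) (a := B x y z w)); last by rewrite /B; zmod_eq.
suff E : B x y z w = - B x y z w.
  by apply: (double_eq0 charF); rewrite {2}E subrr.
(* Rotating and then swapping has order 3, and each round contributes a sign. *)
by rewrite {1}B_rot B_skew (B_rot z) B_skew (B_rot w) (B_skew y x) opprK.
Qed.

Lemma cyc_sum_jacobi u v x y z :
  T (lie u v) (lie x y) z + T (lie u v) (lie y z) x
    + T (lie u v) (lie z x) y = 0.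
Proof.
have E s t r : T (lie u v) (lie s t) r = - T (lie (lie s t) r) u v.
  exact: cyc_sum_lie.
by rewrite !E -!opprD -!cyc_sumD jacobi cyc_sum0 oppr0.
Qed.

(** In the difference of the Jacobi relations for [c] and for [e], [shift] cancels the mixed terms.
    What is left, [T c [x,y] e - T e [x,y] c], is twice the first term by alternation. *)
Lemma cyc_sum_lie3 u v x y s t : T (lie u v) (lie x y) (lie s t) = 0.
Proof.
set c := lie u v; set e := lie s t.
have shift p q : T c (lie p e) q = T e (lie c q) p.
  by rewrite cyc_sum_swap (cyc_sum_lie p e) opprK -cyc_sum_rot.
have skew a p q r : T a (lie p q) r = - T a (lie q p) r.
  by rewrite cyc_sum_rot -lieN cyc_sumN -cyc_sum_rot.
apply: (double_eq0 charF).
apply: (eq_lincomb (f_equal2 +%R (cyc_sum_jacobi u v x y e)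
  (f_equal -%R (cyc_sum_jacobi s t c x y)))).
rewrite -/c -/e shift (skew c e x y) shift (skew e y c x).
rewrite -(cyc_sum_rot c e) (cyc_sum_swapr c e).
by zmod_eq.
Qed.

Lemma cyc_sum_lie_lie x y z w u v : T (lie (lie x y) (lie z w)) u v = 0.
Proof. by rewrite cyc_sum_lie cyc_sum_lie3 oppr0. Qed.

(** * The radical of the cyclic sum and its ideal core *)

Definition cyc_rad a := forall y z, T a y z = 0.

Lemma cyc_radD a b : cyc_rad a -> cyc_rad b -> cyc_rad (a + b).
Proof. by move=> a0 b0 y z; rewrite cyc_sumD a0 b0 addr0. Qed.

Lemma cyc_radN a : cyc_rad a -> cyc_rad (- a).
Proof. by move=> a0 y z; rewrite cyc_sumN a0 oppr0. Qed.

Lemma cyc_radZ k a : cyc_rad a -> cyc_rad (k *: a).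
Proof. by move=> a0 y z; rewrite cyc_sumZ a0 scaler0. Qed.

(** Two of the four cocycle terms have [a] as an argument and vanish. *)
Lemma cyc_rad_shift a y z w :
  cyc_rad a -> T (a ** y) z w = T (w ** a) y z.
Proof.
move=> a0; have := cyc_sum_cocycle a y z w.
rewrite -(cyc_sum_rot a) (cyc_sum_rot (z ** w)) !a0.
by rewrite subr0 addr0 => /subr0_eq.
Qed.

(** Three shifts alternating with two swaps carry [ab] to [ba] without a sign. *)
Lemma cyc_rad_lie a b : cyc_rad a -> cyc_rad (lie a b).
Proof.
move=> a0 y z; rewrite /lie cyc_sumD cyc_sumN; apply/eqP; rewrite subr_eq0.
rewrite (cyc_rad_shift _ _ _ a0) cyc_sum_swapr -(cyc_rad_shift _ _ _ a0).
by rewrite cyc_sum_swapr opprK (cyc_rad_shift _ _ _ a0).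
Qed.

Lemma cyc_rad_mul a b : cyc_rad a -> cyc_rad b -> cyc_rad (a ** b).
Proof. by move=> a0 b0 y z; rewrite (cyc_rad_shift _ _ _ a0) cyc_sum_rot b0. Qed.

Lemma cyc_rad_lie_mulr a b r :
  cyc_rad a -> cyc_rad b -> cyc_rad (lie a b ** r).
Proof.
move=> a0 b0; have -> : lie a b ** r = lie a (b ** r) - b ** lie a r.
  by rewrite lie_mulr addrK.
apply: cyc_radD; first exact: cyc_rad_lie.
by apply/cyc_radN/cyc_rad_mul => //; apply: cyc_rad_lie.
Qed.

Lemma cyc_rad_mull a s :
  cyc_rad a -> cyc_rad (a ** s) -> cyc_rad (s ** a).
Proof.
move=> a0 as0; have -> : s ** a = a ** s - lie a s by rewrite /lie subKr.
by apply: cyc_radD => //; apply/cyc_radN/cyc_rad_lie.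
Qed.

(* The largest two-sided ideal inside the radical. *)
Definition cyc_core a :=
  [/\ cyc_rad a, forall s, cyc_rad (s ** a), forall r, cyc_rad (a ** r)
    & forall s r, cyc_rad (s ** a ** r)].

Lemma cyc_core_ideal : two_sided_ideal cyc_core.
Proof.
split=> [|a b [? ? ? ?] [? ? ? ?]|k a [? ? ? ?]|u a [? ? ? ?]|u a [? ? ? ?]].
- have rad0 : cyc_rad 0 by move=> y z; exact: cyc_sum0.
  by split=> [|s|r|s r]; rewrite ?(linear0r, linear0l).
- by split=> [|s|r|s r]; rewrite ?(linearDr, linearDl); apply: cyc_radD.
- by split=> [|s|r|s r]; rewrite ?(linearZr_LR, linearZl_LR); apply: cyc_radZ.
- by split=> [|s|r|s r]; rewrite ?amulA.
- by split=> [|s|r|s r]; rewrite ?amulA // -amulA.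
Qed.

(** Makes the radical commutative once the core is zero. *)
Lemma cyc_core_lie a b : cyc_rad a -> cyc_rad b -> cyc_core (lie a b).
Proof.
move=> a0 b0; have c0 := cyc_rad_lie b a0.
have cr0 r := cyc_rad_lie_mulr r a0 b0.
split=> // [s|s r]; first exact: cyc_rad_mull.
by rewrite -amulA; apply: cyc_rad_mull => //; rewrite -amulA.
Qed.

Lemma cyc_sum_comm x y z : (forall u v, u ** v = v ** u) -> T x y z = 0.
Proof.
move=> comm; apply: (double_eq0 charF); rewrite {1}cyc_sum_swap /T.
by rewrite (comm y x) (comm z y) (comm x z); zmod_eq.
Qed.

End CyclicSum.

Theorem corollary2p3 (F : fieldType) (charF : 2%N \notin [pchar F])
    (A : assocAlgType F) (simpleA : simple_algebra A)
    (X : lmodType F) (Phi : {bilinear A -> A -> X})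
    (Phi_skew : skew_symmetric Phi)
    (Phi_sq : forall x : A, Phi (x ** x) x = 0) :
  forall x y z : A,
    Phi (x ** y) z + Phi (z ** x) y + Phi (y ** z) x = 0.
Proof.
move=> x y z; rewrite -/(cyc_sum Phi x y z).
have [core0|coreT] := simpleA.2 _ (cyc_core_ideal Phi);
  last by case: (coreT x).
have rad_comm a b : cyc_rad Phi a -> cyc_rad Phi b -> lie a b = 0.
  by move=> a0 b0; apply/core0/cyc_core_lie.
have rad_central a : cyc_rad Phi a -> forall b, lie a b = 0.
  (* [[a,b]] stays in the radical, so [a] commutes with it. *)
  move=> a0; apply: ad_sqr_eq0 => // b.
  by apply: rad_comm => //; apply: cyc_rad_lie.
apply: cyc_sum_comm => // u v; apply: comm_of_central_lie_lie => //.
by move=> *; apply: rad_central => ? ?; apply: cyc_sum_lie_lie.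
Qed.
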